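(* Let $X$ be a real Banach space. The following are equivalent: (1) for every non-zero Banach space $Y$ and every subspace $H\subseteq L(Y,X)$ containing $F(Y,X)$, $H$ is octahedral; (2) $X$ is universally octahedral; (3) for every non-zero finite dimensional Banach space $Y$, $L(Y,X)$ is octahedral; (4) for every non-zero finite dimensional uniformly convex Banach space $Y$, $L(Y,X)$ is octahedral; (5) for every $1<p<\infty$ and every $n\in\mathbb N$, $L(\ell_p^n,X)$ is octahedral; (6) for every $\varepsilon>0$, every finite dimensional subspace $Z$ of $X$ and every $n\in\mathbb N$ there is a linear operator $T:\ell_\infty^n\to X$ with $\|T\|\le1$ such that $\|z+T(y)\|\ge(1-\varepsilon)(\|z\|+\|y\|)$ for all $y\in\ell_\infty^n$, $z\in Z$.
   Context: All Banach spaces are real. $L(Y,X)$ is the space of bounded linear operators from $Y$ to $X$ with the operator norm, $F(Y,X)$ its subspace of finite-rank operators. A Banach space $W$ is octahedral if for every finite dimensional subspace $E$ of $W$ and every $\varepsilon>0$ there exists $y\in W$, $\|y\|=1$, with $\|x+\lambda y\|\ge(1-\varepsilon)(\|x\|+|\lambda|)$ for all $x\in E$, $\lambda\in\mathbb R$. $X$ is universally octahedral if $L(Y,X)$ is octahedral for every non-zero Banach space $Y$. A Banach space is uniformly convex if for every $\varepsilon>0$ there is $\delta>0$ such that $x,y$ in the unit ball with $\|x+y\|>2-\delta$ imply $\|x-y\|<\varepsilon$. *)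

(* Defs.v *)
From HB Require Import structures.
From mathcomp Require Import all_boot all_order all_algebra.
From mathcomp Require Import all_classical all_reals.
From mathcomp Require Import topology normedtype exp.
Set Implicit Arguments. Unset Strict Implicit. Unset Printing Implicit Defensive.
Import Order.TTheory GRing.Theory Num.Theory.
Import numFieldNormedType.Exports.
Local Open Scope classical_set_scope.
Local Open Scope ring_scope.

Section Defs.
Variable R : realType.

Definition in_span (V : lmodType R) (s : seq V) (x : V) : Prop :=
  exists c : 'I_(size s) -> R, x = \sum_(i < size s) c i *: s`_i.

Definition lin_subspace (V : lmodType R) (S : set V) : Prop :=
  S 0 /\ (forall u v, S u -> S v -> S (u + v)) /\
  (forall (a : R) u, S u -> S (a *: u)).

(* The normed space (S, nrm), S a linear subspace of V, is octahedral:
   for every finite dimensional subspace E of S (= the span of finitely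
   many elements of S) and every eps > 0 there is y in S with norm 1 and
   nrm (x + l y) >= (1 - eps) (nrm x + |l|) for x in E, l real. *)
Definition octahedral (V : lmodType R) (S : set V) (nrm : V -> R) : Prop :=
  forall (s : seq V), (forall x, x \in s -> S x) ->
  forall eps : R, 0 < eps ->
  exists2 y, S y &
    nrm y = 1 /\
    forall x, in_span s x -> forall l : R,
      (1 - eps) * (nrm x + `|l|) <= nrm (x + l *: y).

Definition is_linear (Y X : lmodType R) (T : Y -> X) : Prop :=
  forall (a : R) (u v : Y), T (a *: u + v) = a *: T u + T v.

Definition opnorm (Y : lmodType R) (X : normedModType R) (nY : Y -> R)
    (T : Y -> X) : R :=
  sup [set `|T v| | v in [set v | nY v <= 1]].

Definition Lop (Y X : normedModType R) : set (Y -> X) :=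
  [set T | is_linear T /\ exists M : R, forall v, `|T v| <= M * `|v|].
Arguments Lop : clear implicits.

Definition Fop (Y X : normedModType R) : set (Y -> X) :=
  [set T | Lop Y X T /\ exists s : seq X, forall v, in_span s (T v)].

Definition findim (V : lmodType R) : Prop :=
  exists s : seq V, forall v, in_span s v.

Definition nonzero (V : lmodType R) : Prop := exists v : V, v != 0.

Definition univ_octahedral (X : normedModType R) : Prop :=
  forall Y : completeNormedModType R, nonzero Y ->
    octahedral (Lop Y X) (opnorm (fun y : Y => `|y|)).

Definition unif_convex (Y : normedModType R) : Prop :=
  forall eps : R, 0 < eps -> exists2 delta : R, 0 < delta &
    forall x y : Y, `|x| <= 1 -> `|y| <= 1 -> 2 - delta < `|x + y| ->
      `|x - y| < eps.

Definition lpnorm (n : nat) (p : R) (v : 'rV[R]_n) : R :=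
  (\sum_(i < n) `|v ord0 i| `^ p) `^ p^-1.

Definition linfnorm (n : nat) (v : 'rV[R]_n) : R :=
  \big[Num.max/0]_(i < n) `|v ord0 i|.

(* L(l_p^n, X): all linear maps (automatically bounded) *)
Definition Lfin (n : nat) (X : lmodType R) : set ('rV[R]_n -> X) :=
  [set T | is_linear T].

End Defs.

Arguments Lop {R} Y X.
Arguments Fop {R} Y X.
Arguments Lfin {R} n X.

(* Main.v *)
(* From (5) to (6): if [T] is almost octahedral with respect to the operators
   [f (x) z] of rank one, with [f] norming a unit vector [y] of l_p^n, then
   [f (x) z + T] almost attains its norm at some [u], and uniform convexity
   forces [u] to be close to [y] or [-y]; hence [|z + T y|] is almost 2.  For
   large [p] the norms of l_p^n and l_oo^n almost coincide.

   From (6) to (1): by compactness a finite dimensional space of operators is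
   almost normed by finitely many unit vectors [y_i].  If [f_i] norms [y_i],
   then [y |-> T (f_1 y, ..., f_n y)], with [T] given by (6) for the span of the
   images of the [y_i], is the required operator, of finite rank. *)
Require Import Defs.
From HB Require Import structures.
From mathcomp Require Import all_boot all_order all_algebra.
From mathcomp Require Import all_classical all_reals.
From mathcomp Require Import topology normedtype sequences exp.
From mathcomp Require Import ring lra.
Import Order.TTheory GRing.Theory Num.Theory.
Import numFieldNormedType.Exports.
Local Open Scope classical_set_scope.
Local Open Scope ring_scope.

(** * Strict tangent inequalities for powers *)

Lemma powR_bernoulli_lt {R : realType} (p a : R) :
  1 < p -> 0 <= a -> a != 1 -> 1 + p * (a - 1) < a `^ p.
Proof.
move=> p1 a0 aN1; have p0 : 0 < p by exact: lt_trans p1.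
have [->|aN0] := eqVneq a 0.
  by rewrite powR0 ?gt_eqF//; lra.
have {aN0}a0 : 0 < a by rewrite lt_def aN0.
(* Strict convexity of the exponential: compare its values at [p * ln a] and
   at [0] with its tangent at [ln a]. *)
have lna0 : ln a != 0 by rewrite ln_eq0.
have h1 : 1 + (p - 1) * ln a < expR ((p - 1) * ln a).
  by apply: expR_gt1Dx; rewrite mulf_neq0// subr_eq0 gt_eqF.
have h2 : 1 - ln a < expR (- ln a).
  by apply: expR_gt1Dx; rewrite oppr_eq0.
have e1 : expR ((p - 1) * ln a) * a = a `^ p.
  rewrite /powR gt_eqF// -{2}(@lnK _ a) ?posrE// -expRD.
  by rewrite mulrBl mul1r subrK.
have e2 : expR (- ln a) * a = 1.
  by rewrite -{2}(@lnK _ a) ?posrE// -expRD addNr expR0.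
move: h1; rewrite -(ltr_pM2r a0) e1 => h1.
move: h2; rewrite -(ltr_pM2r a0) e2 => h2.
(* Added to [h1], this cancels the terms in [ln a] and leaves p a < a^p + p - 1. *)
have h3 : (p - 1) * ((1 - ln a) * a) < (p - 1) * 1 by rewrite ltr_pM2l ?subr_gt0.
nra.
Qed.

(** Strict convexity of |t|^p. For b non-zero, division by |b|^p reduces it to the Bernoulli
    inequality at |a|/|b|, because [Num.sg b * a] is at most |a|; when |a| = |b|, this last bound is
    itself strict. *)
Lemma powR_abs_tangent_lt {R : realType} (p a b : R) : 1 < p -> a != b ->
  `|b| `^ p + p * (`|b| `^ (p - 1) * Num.sg b * (a - b)) < `|a| `^ p.
Proof.
move=> p1 ab; have p0 : 0 < p by exact: lt_trans p1.
have [b0|bN0] := eqVneq b 0.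
  rewrite b0 normr0 !powR0 ?gt_eqF ?subr_gt0// !mul0r mulr0 addr0 powR_gt0//.
  by rewrite normr_gt0 -b0.
have nb0 : 0 < `|b| by rewrite normr_gt0.
have pb : `|b| * `|b| `^ (p - 1) = `|b| `^ p by rewrite mulr_powRB1.
have pb0 : 0 < `|b| `^ (p - 1) by exact: powR_gt0.
have sgb : Num.sg b * b = `|b| by rewrite -normrEsg.
have sga : Num.sg b * a <= `|a|.
  by rewrite (le_trans (ler_norm _))// normrM normr_sg bN0 mul1r.
have [eab|nab] := eqVneq `|a| `|b|.
  rewrite eab gtrDl pmulr_rlt0// -mulrA pmulr_rlt0// mulrBr sgb.
  rewrite subr_lt0 lt_neqAle -{2}eab sga andbT.
  apply: contra ab => /eqP; rewrite -sgb => /mulfI; rewrite sgr_eq0 => /(_ bN0) ->.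
  exact: eqxx.
have : 1 + p * (`|a| / `|b| - 1) < (`|a| / `|b|) `^ p.
  apply: powR_bernoulli_lt => //; first by rewrite divr_ge0.
  by apply: contra nab => /eqP/divr1_eq ->.
have pbp : 0 < `|b| `^ p by exact: powR_gt0.
have -> : (`|a| / `|b|) `^ p = `|a| `^ p / `|b| `^ p.
  rewrite powRM ?invr_ge0//; congr (_ * _).
  by rewrite -[_^-1]powR_inv1// -powRrM mulN1r powRN.
rewrite ltr_pdivlMr//; apply: le_lt_trans.
rewrite mulrDl mul1r lerD2l -(mulrA p) ler_pM2l// -pb mulrA mulrBl.
rewrite divfK ?gt_eqF// mul1r [leRHS]mulrC -mulrA ler_pM2l//.
by rewrite mulrBr sgb lerB.
Qed.

(* A locked copy of [lpnorm]: unification otherwise unfolds [lpnorm] down to the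
   power series of the exponential. *)
HB.lock Definition lpN {R : realType} {n : nat} (p : R) (v : 'rV[R]_n) : R :=
  lpnorm p v.

(** * The norm of l_p^n: norming functionals, strict and uniform convexity *)

Section lpnorm_theory.
Context {R : realType} {n : nat} (p : R).
Hypothesis p1 : 1 < p.
Implicit Types u v y : 'rV[R]_n.

Let p0 : 0 < p. Proof. exact: lt_trans p1. Qed.
Let p_neq0 : p != 0. Proof. by rewrite gt_eqF. Qed.

Lemma lpnorm_ge0 v : 0 <= lpN p v.
Proof. by rewrite lpN.unlock powR_ge0. Qed.

Let sum_ge0 v : 0 <= \sum_(i < n) `|v ord0 i| `^ p.
Proof. by apply: sumr_ge0 => i _; exact: powR_ge0. Qed.

Lemma lpnorm_powR v : lpN p v `^ p = \sum_(i < n) `|v ord0 i| `^ p.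
Proof. by rewrite lpN.unlock /lpnorm -powRrM mulVf// powRr1. Qed.

Lemma lpnormZ (a : R) v : lpN p (a *: v) = `|a| * lpN p v.
Proof.
apply: (@powR_injective _ p p0); rewrite ?nnegrE ?mulr_ge0 ?lpnorm_ge0//.
rewrite powRM ?lpnorm_ge0// !lpnorm_powR mulr_sumr; apply: eq_bigr => i _.
by rewrite mxE normrM powRM.
Qed.

Lemma lpnormN v : lpN p (- v) = lpN p v.
Proof. by rewrite -scaleN1r lpnormZ normrN1 mul1r. Qed.

Lemma lpnorm0 : lpN p (0 : 'rV[R]_n) = 0.
Proof. by rewrite -(scale0r (0 : 'rV[R]_n)) lpnormZ normr0 mul0r. Qed.

Lemma coord_le_lpnorm v i : `|v ord0 i| <= lpN p v.
Proof.
rewrite leNgt; apply/negP => /(gt0_ltr_powR p0).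
rewrite !nnegrE lpnorm_ge0 normr_ge0 => /(_ isT isT); rewrite lpnorm_powR.
by apply/negP; rewrite -leNgt (bigD1 i)//= lerDl sumr_ge0// => j _; exact: powR_ge0.
Qed.

Lemma linfnorm_le_lpnorm v : linfnorm v <= lpN p v.
Proof.
by apply: bigmax_le; [exact: lpnorm_ge0|move=> i _; exact: coord_le_lpnorm].
Qed.

Lemma lpnorm_le_linfnorm v : lpN p v <= n%:R `^ p^-1 * linfnorm v.
Proof.
have ge0 : 0 <= linfnorm v by apply: bigmax_ge_id.
rewrite leNgt; apply/negP => /(gt0_ltr_powR p0).
rewrite !nnegrE lpnorm_ge0 mulr_ge0 ?powR_ge0// => /(_ isT isT).
apply/negP; rewrite -leNgt lpnorm_powR powRM ?powR_ge0// -powRrM mulVf// powRr1//.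
have -> : n%:R * linfnorm v `^ p = \sum_(i < n) linfnorm v `^ p.
  by rewrite sumr_const card_ord mulr_natl.
apply: ler_sum => i _; rewrite ge0_ler_powR ?(ltW p0) ?nnegrE//.
exact: (le_bigmax _ (fun i => `|v ord0 i|)).
Qed.

Lemma lpnorm_eq0 v : lpN p v = 0 -> v = 0.
Proof.
move=> v0; apply/rowP => i; rewrite mxE; apply/eqP.
by rewrite -normr_eq0 eq_le normr_ge0 andbT -v0 coord_le_lpnorm.
Qed.

(* The norming functional of [y], when [lpN p y = 1]. *)
Definition lpdual y u : R :=
  \sum_(i < n) `|y ord0 i| `^ (p - 1) * Num.sg (y ord0 i) * u ord0 i.

Lemma lpdualD y u v : lpdual y (u + v) = lpdual y u + lpdual y v.
Proof.
by rewrite /lpdual -big_split/=; apply: eq_bigr => i _; rewrite mxE mulrDr.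
Qed.

Lemma lpdualZ y (a : R) u : lpdual y (a *: u) = a * lpdual y u.
Proof.
by rewrite /lpdual mulr_sumr; apply: eq_bigr => i _; rewrite mxE mulrCA.
Qed.

Lemma lpdual_self y : lpdual y y = lpN p y `^ p.
Proof.
rewrite lpnorm_powR; apply: eq_bigr => i _.
by rewrite -mulrA -normrEsg mulrC mulr_powRB1.
Qed.

(** Summing the tangent inequalities at the coordinates of y bounds p ([lpdual y u] - 1) by the
    difference of the sums of |u_i|^p and |y_i|^p, which is at most 0. A coordinate where u and y
    differ makes the bound strict. So [lpdual y] reaches 1 on the unit ball only at y. *)
Lemma lpdual_lt1 y u : lpN p y = 1 -> lpN p u <= 1 -> u != y ->
  lpdual y u < 1.
Proof.
move=> y1 u1 uy.
have [i uyi] : exists i, u ord0 i != y ord0 i.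
  apply/existsP; rewrite -negb_forall; apply: contra uy => /forallP uy.
  by apply/eqP/rowP => i; exact/eqP.
have Su1 : \sum_(i < n) `|u ord0 i| `^ p <= 1.
  have := ge0_ler_powR (ltW p0) (lpnorm_ge0 u) ler01 u1.
  by rewrite powR1 lpnorm_powR.
have Sy1 : \sum_(i < n) `|y ord0 i| `^ p = 1 by rewrite -lpnorm_powR y1 powR1.
suff : p * (lpdual y u - 1) < 0 by rewrite pmulr_rlt0// subr_lt0.
have yy1 : lpdual y y = 1 by rewrite lpdual_self y1 powR1.
rewrite -[in X in _ - X]yy1.
rewrite -(mulN1r (lpdual y y)) -lpdualZ -lpdualD scaleN1r.
apply: (@lt_le_trans _ _ (\sum_(i < n) (`|u ord0 i| `^ p - `|y ord0 i| `^ p))).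
  rewrite /lpdual mulr_sumr (bigD1 i)//= [ltRHS](bigD1 i)//=; apply: ltr_leD.
    by rewrite !mxE ltrBrDl; exact: powR_abs_tangent_lt.
  apply: ler_sum => j _; rewrite !mxE lerBrDl.
  have [->|neq] := eqVneq (u ord0 j) (y ord0 j).
    by rewrite subrr !mulr0 addr0.
  exact/ltW/powR_abs_tangent_lt.
by rewrite sumrB Sy1 subr_le0.
Qed.

Lemma lpdual_le y u : lpN p y = 1 -> `|lpdual y u| <= lpN p u.
Proof.
move=> y1.
have le1 v : lpN p v <= 1 -> lpdual y v <= 1.
  have [->|vy v1] := eqVneq v y; first by rewrite lpdual_self y1 powR1.
  exact/ltW/lpdual_lt1.
have le v : lpdual y v <= lpN p v.
  have [v0|vN0] := eqVneq (lpN p v) 0.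
    by rewrite (lpnorm_eq0 v v0) -(scale0r y) lpdualZ mul0r lpnorm_ge0.
  have v0 : 0 < lpN p v by rewrite lt_def vN0 lpnorm_ge0.
  have := le1 ((lpN p v)^-1 *: v); rewrite lpnormZ lpdualZ.
  rewrite ger0_norm ?invr_ge0 ?lpnorm_ge0// mulVf// => /(_ (lexx _)).
  by rewrite mulrC ler_pdivrMr// mul1r.
by rewrite ler_norml lerNl -mulN1r -lpdualZ scaleN1r -{1}(lpnormN u) !le.
Qed.

(** Minkowski's inequality by duality: for y the normalised sum, the norm of u + v equals
    [lpdual y u + lpdual y v]. *)
Lemma lpnormD u v : lpN p (u + v) <= lpN p u + lpN p v.
Proof.
set w := u + v; have [->|wN0] := eqVneq (lpN p w) 0.
  by rewrite addr_ge0 ?lpnorm_ge0.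
have w0 : 0 < lpN p w by rewrite lt_def wN0 lpnorm_ge0.
pose y := (lpN p w)^-1 *: w.
have y1 : lpN p y = 1.
  by rewrite lpnormZ ger0_norm ?invr_ge0 ?lpnorm_ge0// mulVf.
have -> : lpN p w = lpdual y w.
  have -> : w = lpN p w *: y by rewrite scalerA mulfV// scale1r.
  by rewrite lpdualZ lpdual_self lpnormZ y1 powR1 ger0_norm// lpnorm_ge0.
by rewrite lpdualD lerD// (le_trans (ler_norm _))// lpdual_le.
Qed.

(** If the sum had norm 2, the midpoint y would be a unit vector and [lpdual y] would equal 1 at
    both u and v, so both would be y. *)
Lemma lpnorm_strictly_convex u v : lpN p u <= 1 -> lpN p v <= 1 ->
  u != v -> lpN p (u + v) < 2.
Proof.
move=> u1 v1 uv.
rewrite lt_neqAle (le_trans (lpnormD u v)) ?andbT; last first.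
  by rewrite -[2]/(1 + 1) lerD.
apply/negP => /eqP uv2; pose y := 2^-1 *: (u + v).
have y1 : lpN p y = 1.
  by rewrite lpnormZ uv2 ger0_norm ?invr_ge0// mulVf ?pnatr_eq0.
have : lpdual y u + lpdual y v = 2.
  rewrite -lpdualD; have -> : u + v = 2 *: y by rewrite scalerA mulfV ?pnatr_eq0// scale1r.
  by rewrite lpdualZ lpdual_self y1 powR1 mulr1.
have le1 w : lpN p w <= 1 -> lpdual y w <= 1.
  by move=> w1; rewrite (le_trans (ler_norm _))// (le_trans (lpdual_le y w y1)).
have [uy|uy] := eqVneq u y; last first.
  have := lpdual_lt1 y u y1 u1 uy; have := le1 v v1; lra.
have vy : v != y by rewrite -uy eq_sym.
have := lpdual_lt1 y v y1 v1 vy; have := le1 u u1; lra.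
Qed.

Lemma ler_lpnormB u v : `|lpN p u - lpN p v| <= lpN p (u - v).
Proof.
have := lpnormD (u - v) v; have := lpnormD (v - u) u.
rewrite !subrK -[v - u]opprB lpnormN ler_norml; lra.
Qed.

Lemma linfnorm_mx_norm u : linfnorm u = `|u|.
Proof.
rewrite [RHS]mx_normrE; apply/eqP; rewrite eq_le; apply/andP; split.
  apply: bigmax_le; first by exact: bigmax_ge_id.
  by move=> i _; exact: (le_bigmax _ (fun ij : 'I_1 * 'I_n => `|u ij.1 ij.2|) (ord0, i)).
apply: bigmax_le; first by exact: bigmax_ge_id.
by move=> [i j] _ /=; rewrite ord1; exact: (le_bigmax _ (fun j => `|u ord0 j|)).
Qed.

Lemma mx_norm_le_lpnorm u : `|u| <= lpN p u.
Proof. by rewrite -linfnorm_mx_norm linfnorm_le_lpnorm. Qed.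

Lemma lpnorm_le_mx_norm u : lpN p u <= n%:R `^ p^-1 * `|u|.
Proof. by rewrite -linfnorm_mx_norm lpnorm_le_linfnorm. Qed.

Lemma lpnorm_continuous : continuous (@lpN R n p).
Proof.
move=> u; apply/(@cvgrPdist_lt _ _ _ (nbhs u)) => e e0.
near=> v; rewrite (le_lt_trans (ler_lpnormB _ _))//.
rewrite (le_lt_trans (lpnorm_le_mx_norm _))//.
(* The added 1 keeps the constant positive for n = 0 as well. *)
rewrite (@le_lt_trans _ _ ((n%:R `^ p^-1 + 1) * `|u - v|))//.
  by rewrite ler_wpM2r// lerDl.
rewrite mulrC -ltr_pdivlMr ?ltr_wpDl ?powR_ge0//.
near: v; apply: cvgr_dist_lt => //; first by rewrite divr_gt0// ltr_wpDl ?powR_ge0.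
Unshelve. all: by end_near. Qed.

(** Compactness of the product of two unit balls makes strict convexity uniform: near each pair, and
    for all small delta, the implication holds. *)
Lemma lpnorm_uniformly_convex (eps : R) : 0 < eps ->
  exists2 delta : R, 0 < delta &
    forall u v, lpN p u <= 1 -> lpN p v <= 1 ->
      2 - delta < lpN p (u + v) -> lpN p (u - v) < eps.
Proof.
move=> eps0; pose B := [set u : 'rV[R]_n | lpN p u <= 1].
have cB : compact B.
  apply: bounded_closed_compact.
    exists 1; split => // M M1 u u1; apply: (le_trans (mx_norm_le_lpnorm u)).
    exact/ltW/(le_lt_trans u1).
  apply: (@closed_comp _ _ (@lpN R n p) [set x | x <= 1]); last exact: closed_le.
  by move=> u _; exact: lpnorm_continuous.
have cN (f : 'rV[R]_n * 'rV[R]_n -> 'rV[R]_n) x : {for x, continuous f} ->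
    lpN p (f y) @[y --> x] --> lpN p (f x).
  by move=> fx; apply: continuous_comp => //; exact: lpnorm_continuous.
have near_unif : \forall d \near (0 : R)^'+, B `*` B `<=` [set uv |
    2 - d < lpN p (uv.1 + uv.2) -> lpN p (uv.1 - uv.2) < eps].
  have /compact_near_coveringP/near_covering_withinP cBB := compact_setX cB cB.
  apply: (cBB _ _ (fun d uv => 2 - d < lpN p (uv.1 + uv.2) ->
    lpN p (uv.1 - uv.2) < eps)) => -[u v] [/= u1 v1].
  have [uv|uv] := ltP (lpN p (u - v)) eps.
    near=> x d => _ _ /=.
    near: x; apply: (cvgr_lt (lpN p (u - v))) => //.
    by apply: (cN (fun x => x.1 - x.2) (u, v)); exact: sub_continuous.
  have uv2 : lpN p (u + v) < 2.
    apply: lpnorm_strictly_convex => //; apply: contraTneq uv => ->.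
    by rewrite subrr lpnorm0 -ltNge.
  (* Near such a pair the implication is vacuous: a sum of norm below 2 - m violates its premise as
     soon as d < m. *)
  pose m := (2 - lpN p (u + v)) / 2.
  have m0 : 0 < m by rewrite divr_gt0// subr_gt0.
  near=> x d => _ /=.
  suff : lpN p (x.1 + x.2) < 2 - m /\ d < m by move=> [? ?]; lra.
  split.
    near: x; apply: (cvgr_lt (lpN p (u + v))); last by rewrite /m; lra.
    by apply: (cN (fun x => x.1 + x.2) (u, v)); exact: add_continuous.
  by near: d; exact: nbhs_right_lt.
near (0 : R)^'+ => d; exists d; first by near: d; exact: nbhs_right_gt.
move=> u v u1 v1.
suff : B `*` B `<=` [set uv |
    2 - d < lpN p (uv.1 + uv.2) -> lpN p (uv.1 - uv.2) < eps].
  by move=> /(_ (u, v)); apply.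
by near: d.
Unshelve. all: by end_near. Qed.

End lpnorm_theory.
(* A copy of the row vectors, since ['rV[R]_n] itself carries the sup norm. *)
Definition lpSpace {R : realType} (p : R) (p1 : 1 < p) (n : nat) := 'rV[R]_n.

(** * l_p^n as a uniformly convex Banach space *)

Section lpSpace_instances.
Context {R : realType} (p : R) (p1 : 1 < p) (n : nat).
Local Notation Y := (lpSpace p p1 n).

HB.instance Definition _ := GRing.Lmodule.on Y.
HB.instance Definition _ := @Lmodule_isNormed.Build R Y (@lpN R n p)
  (lpnormD p p1) (lpnormZ p p1) (lpnorm_eq0 p p1).

Lemma lpSpace_normE (y : Y) : `|y| = lpnorm p y.
Proof. by rewrite -[LHS]/(lpN p y) lpN.unlock. Qed.

(** Completeness is inherited from the sup norm, which is equivalent to [lpN p]. *)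
Lemma lpSpace_complete (F : set_system Y) : ProperFilter F -> cauchy F -> cvg F.
Proof.
move=> FF /cauchy_ballP cF.
have cF' : cauchy (F : set_system 'rV[R]_n).
  apply/cauchy_ballP => e e0; apply: filterS (cF e e0) => -[u v].
  rewrite -!ball_normE /=; apply: le_lt_trans; exact: mx_norm_le_lpnorm.
have /cvg_ex[/= l Fl] := @cauchy_cvg 'rV[R]_n F FF cF'.
apply/cvg_ex; exists l; apply/cvgrPdist_lt => e e0.
pose C := n%:R `^ p^-1 + 1 : R.
have C0 : 0 < C by rewrite ltr_wpDl ?powR_ge0.
move/cvgrPdist_lt : Fl => /(_ (e / C)); rewrite divr_gt0// => /(_ isT).
apply: filterS => v; rewrite ltr_pdivlMr// mulrC; apply: le_lt_trans.
apply: (le_trans (lpnorm_le_mx_norm p p1 _)).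
by rewrite ler_wpM2r// lerDl.
Qed.

HB.instance Definition _ := Uniform_isComplete.Build Y lpSpace_complete.

Lemma lpSpace_unif_convex : unif_convex Y.
Proof. exact: lpnorm_uniformly_convex. Qed.

End lpSpace_instances.

(** * Linear spans and linear maps *)

Section linear_span.
Context {R : realType} {V W : lmodType R}.
Implicit Types (s : seq V) (T : V -> W).

Lemma in_span0 s : in_span s 0.
Proof. by exists (fun=> 0); rewrite big1// => i _; rewrite scale0r. Qed.

Lemma in_spanD s x y : in_span s x -> in_span s y -> in_span s (x + y).
Proof.
move=> [c ->] [d ->]; exists (fun i => c i + d i).
by rewrite -big_split/=; apply: eq_bigr => i _; rewrite scalerDl.
Qed.

Lemma in_spanZ s a x : in_span s x -> in_span s (a *: x).
Proof.
move=> [c ->]; exists (fun i => a * c i).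
by rewrite scaler_sumr; apply: eq_bigr => i _; rewrite scalerA.
Qed.

Lemma lin_subspace_span s : lin_subspace [set x | in_span s x].
Proof.
split; [exact: in_span0|split => [u v|a u]]; [exact: in_spanD|exact: in_spanZ].
Qed.

Lemma mem_in_span s x : x \in s -> in_span s x.
Proof.
rewrite -index_mem => xs; exists (fun i => (i == Ordinal xs)%:R).
rewrite (bigD1 (Ordinal xs))//= eqxx scale1r nth_index -?index_mem// big1 ?addr0//.
by move=> i /negPf ->; rewrite scale0r.
Qed.

Lemma lin_subspace_sum (S : set V) (I : Type) (r : seq I) (P : pred I)
    (F : I -> V) : lin_subspace S -> (forall i, P i -> S (F i)) ->
  S (\sum_(i <- r | P i) F i).
Proof. by move=> [S0 [SD _]] SF; elim/big_ind : _. Qed.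

Lemma in_span_sub s (S : set V) x : lin_subspace S -> (forall y, y \in s -> S y) ->
  in_span s x -> S x.
Proof.
move=> SS sS [c ->]; apply: lin_subspace_sum => // i _.
by apply: SS.2.2; apply: sS; rewrite mem_nth.
Qed.

Lemma is_linearD T u v : is_linear T -> T (u + v) = T u + T v.
Proof. by move=> TL; have := TL 1 u v; rewrite !scale1r. Qed.

Lemma is_linear0 T : is_linear T -> T 0 = 0.
Proof.
move=> TL; have := is_linearD T 0 0 TL; rewrite addr0 => /esym/eqP.
by rewrite addrC -subr_eq0 addrK => /eqP.
Qed.

Lemma is_linearZ T a v : is_linear T -> T (a *: v) = a *: T v.
Proof. by move=> TL; have := TL a v 0; rewrite is_linear0// !addr0. Qed.

Lemma is_linearN T v : is_linear T -> T (- v) = - T v.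
Proof. by move=> TL; rewrite -scaleN1r is_linearZ// scaleN1r. Qed.

Lemma is_linearB T u v : is_linear T -> T (u - v) = T u - T v.
Proof. by move=> TL; rewrite is_linearD// is_linearN. Qed.

Lemma is_linear_sum T (I : Type) (r : seq I) (P : pred I) (F : I -> V) :
  is_linear T -> T (\sum_(i <- r | P i) F i) = \sum_(i <- r | P i) T (F i).
Proof.
move=> TL; elim/big_rec2 : _ => [|i x y _ <-]; first exact: is_linear0.
exact: is_linearD.
Qed.

Lemma is_linear_lin_subspace : lin_subspace [set T : V -> W | is_linear T].
Proof.
split.
  by move=> a u v; rewrite -[LHS]/(0 : W) -[RHS]/(a *: 0 + 0 : W) scaler0 addr0.
split=> [S T SL TL a u v|b T TL a u v]; rewrite !fctE.
  by rewrite SL TL scalerDr addrACA.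
by rewrite TL scalerDr !scalerA mulrC.
Qed.

End linear_span.

(** * Operator norms *)

Section opnorm_theory.
Context {R : realType} {Y : lmodType R} {X : normedModType R} (nY : Y -> R).
Implicit Types S T : Y -> X.

(** This makes the [sup] in [opnorm] a genuine supremum. The gauge [nY] stays abstract so that the
    same lemmas serve the norm of a normed space, [lpN p] and [linfnorm]. *)
Definition ball_bounded T := exists M : R, forall v, nY v <= 1 -> `|T v| <= M.

Lemma le_opnorm T v : ball_bounded T -> nY v <= 1 -> `|T v| <= opnorm nY T.
Proof.
move=> [M TM] v1; apply: ub_le_sup; last by exists v.
by exists M => _ [u u1 <-]; exact: TM.
Qed.

Lemma ball_boundedD S T : ball_bounded S -> ball_bounded T -> ball_bounded (S + T).
Proof.
move=> [M SM] [N TN]; exists (M + N) => v v1.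
by rewrite fctE (le_trans (ler_normD _ _))// lerD ?SM ?TN.
Qed.

Lemma ball_boundedZ a T : ball_bounded T -> ball_bounded (a *: T).
Proof.
by move=> [M TM]; exists (`|a| * M) => v v1; rewrite fctE normrZ ler_wpM2l ?TM.
Qed.

Hypothesis nY0 : nY 0 <= 1.

Lemma opnorm_le T M : (forall v, nY v <= 1 -> `|T v| <= M) -> opnorm nY T <= M.
Proof.
move=> TM; apply: ge_sup; first by exists `|T 0|, 0.
by move=> _ [v v1 <-]; exact: TM.
Qed.

Lemma lt_opnorm_ex T m : m < opnorm nY T -> exists2 v, nY v <= 1 & m < `|T v|.
Proof.
by move=> /sup_gt[|_ [v v1 <-] mv]; [exists `|T 0|, 0|exists v].
Qed.

Lemma opnorm_ge0 T : ball_bounded T -> 0 <= opnorm nY T.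
Proof. by move=> Tb; apply: (le_trans (normr_ge0 (T 0))); exact: le_opnorm. Qed.

Lemma opnormD S T : ball_bounded S -> ball_bounded T ->
  opnorm nY (S + T) <= opnorm nY S + opnorm nY T.
Proof.
move=> Sb Tb; apply: opnorm_le => v v1.
by rewrite fctE (le_trans (ler_normD _ _))// lerD ?le_opnorm.
Qed.

Lemma opnormZ a T : ball_bounded T -> opnorm nY (a *: T) = `|a| * opnorm nY T.
Proof.
have le b S : ball_bounded S -> opnorm nY (b *: S) <= `|b| * opnorm nY S.
  by move=> Sb; apply: opnorm_le => v v1; rewrite fctE normrZ ler_wpM2l ?le_opnorm.
move=> Tb; apply/eqP; rewrite eq_le le//=.
have [->|a0] := eqVneq a 0.
  by rewrite normr0 mul0r opnorm_ge0//; exact: ball_boundedZ.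
(* The reverse inequality is the first one for the inverse scalar, applied to [a *: T]. *)
have := le a^-1 _ (ball_boundedZ a T Tb).
by rewrite scalerA mulVf// scale1r normfV mulrC ler_pdivlMr ?normr_gt0// mulrC.
Qed.

Hypothesis nYZ : forall a v, nY (a *: v) = `|a| * nY v.
Hypothesis nY_ge0 : forall v, 0 <= nY v.
Hypothesis nY_eq0 : forall v, nY v = 0 -> v = 0.

Lemma le_opnormM T v : is_linear T -> ball_bounded T ->
  `|T v| <= opnorm nY T * nY v.
Proof.
move=> TL Tb; have [v0|vN0] := eqVneq (nY v) 0.
  by rewrite (nY_eq0 _ v0) is_linear0// normr0 mulr_ge0// opnorm_ge0.
have v0 : 0 < nY v by rewrite lt_def vN0 nY_ge0.
rewrite -ler_pdivrMr//.
have := le_opnorm T ((nY v)^-1 *: v) Tb.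
rewrite nYZ is_linearZ// normrZ ger0_norm ?invr_ge0 ?(ltW v0)// mulVf//.
by rewrite mulrC; exact.
Qed.

End opnorm_theory.

Section bounded_operators.
Context {R : realType} {Y X : normedModType R}.
Implicit Types T : Y -> X.

Lemma Lop_ball_bounded T : Lop Y X T -> ball_bounded (fun y : Y => `|y|) T.
Proof.
move=> [_ [M TM]]; exists `|M| => v v1.
by rewrite (le_trans (TM v))// (le_trans (ler_norm _))// normrM normr_id ler_piMr.
Qed.

Lemma Lop_lin_subspace : lin_subspace (Lop Y X).
Proof.
have [L0 [LD LZ]] := @is_linear_lin_subspace R Y X.
split; first by split => //; exists 0 => v; rewrite normr0 mul0r.
split=> [S T [SL [M SM]] [TL [N TN]]|a T [TL [N TN]]].
  split; first exact: LD.
  by exists (M + N) => v; rewrite fctE (le_trans (ler_normD _ _))// mulrDl lerD.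
split; first exact: LZ.
by exists (`|a| * N) => v; rewrite fctE normrZ -mulrA ler_wpM2l.
Qed.

End bounded_operators.

Section row_operators.
Context {R : realType} {n : nat} {X : normedModType R}.
Implicit Types T : 'rV[R]_n -> X.

Lemma is_linear_row_bound T (v : 'rV[R]_n) (M : R) : is_linear T ->
    (forall i, `|v ord0 i| <= M) ->
  `|T v| <= (\sum_(i < n) `|T (delta_mx ord0 i)|) * M.
Proof.
move=> TL vM; rewrite {1}(row_sum_delta v) is_linear_sum//.
rewrite (le_trans (ler_norm_sum _ _ _))// mulr_suml ler_sum// => i _.
by rewrite is_linearZ// normrZ mulrC ler_wpM2l.
Qed.

Lemma Lfin_lpnorm_bounded (p : R) T : 1 < p -> is_linear T ->
  ball_bounded (@lpN R n p) T.
Proof.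
move=> p1 TL; exists (\sum_(i < n) `|T (delta_mx ord0 i)|) => v v1.
rewrite -[leRHS]mulr1; apply: is_linear_row_bound => // i.
exact: le_trans (coord_le_lpnorm p p1 v i) v1.
Qed.

End row_operators.

(** * From (4) to (5) *)

(** The hypothesis is applied to [lpSpace]. All linear maps on it are bounded, so [Lop] and [Lfin]
    agree, and a dimension of the form [n.+1] makes it non-zero. *)
Lemma octahedral_Lfin_lpnorm {R : realType} {X : completeNormedModType R}
    (p : R) (n : nat) : 1 < p ->
  (forall Y : completeNormedModType R, nonzero Y -> findim Y ->
      unif_convex Y -> octahedral (Lop Y X) (opnorm (fun y : Y => `|y|))) ->
  octahedral (Lfin n.+1 X) (opnorm (@lpnorm R n.+1 p)).
Proof.
move=> p1 H; pose Y := lpSpace p p1 n.+1.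
have LopE : Lop Y X = Lfin n.+1 X.
  apply/seteqP; split=> [T []//|T TL]; split => //.
  exists (\sum_(i < n.+1) `|T (delta_mx ord0 i)|) => v.
  apply: is_linear_row_bound => // i; exact: (coord_le_lpnorm p p1 v i).
have := H Y; rewrite LopE.
have -> : (fun y : Y => `|y|) = @lpnorm R n.+1 p.
  by apply/funext => y; exact: lpSpace_normE.
apply.
- exists (const_mx 1 : 'rV[R]_n.+1); apply/eqP => /rowP/(_ ord0).
  by rewrite !mxE => /eqP; rewrite oner_eq0.
- exists [seq (delta_mx ord0 i : 'rV[R]_n.+1) | i <- enum 'I_n.+1] => v.
  rewrite (row_sum_delta (v : 'rV[R]_n.+1)).
  apply: (@lin_subspace_sum _ _ [set x | in_span _ x]).
    exact: lin_subspace_span.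
  by move=> i _; apply: in_spanZ; apply: mem_in_span; rewrite map_f// mem_enum.
- exact: lpSpace_unif_convex.
Qed.

(** * From (5) to (6) *)

(** For b <= a, the identity a z + b w = a (z + w) - (a - b) w gives the lower bound a (2 - k) - (a
    - b) = a + b - k a. It carries an estimate for unit vectors over to all vectors. *)
Lemma norm_add_ge_homogeneous {R : realType} {X : normedModType R} (z w : X)
    (k a b : R) : 0 <= k -> 0 <= a -> 0 <= b -> `|z| <= 1 -> `|w| <= 1 ->
  2 - k <= `|z + w| -> (1 - k) * (a + b) <= `|a *: z + b *: w|.
Proof.
wlog ba : z w a b / b <= a.
  move=> H k0 a0 b0 z1 w1 zw; have [ba|/ltW ab] := leP b a; first exact: H.
  by rewrite (addrC a) (addrC (a *: z)); apply: H => //; rewrite (addrC w).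
move=> k0 a0 b0 z1 w1 zw.
have -> : a *: z + b *: w = a *: (z + w) - (a - b) *: w.
  by rewrite scalerDr scalerBl opprB -addrA [_ + (b *: w - _)]addrC subrK.
apply: le_trans (lerB_dist _ _); rewrite !normrZ (ger0_norm a0) ger0_norm ?subr_ge0//.
have h1 : a * (2 - k) <= a * `|z + w| by rewrite ler_wpM2l.
have h2 : (a - b) * `|w| <= a - b by rewrite ler_piMr ?subr_ge0.
have h3 : 0 <= k * b by rewrite mulr_ge0.
nra.
Qed.

Section lp_octahedral.
Context {R : realType} {X : normedModType R} {n : nat} (p : R).
Hypothesis p1 : 1 < p.

Let lpN0_le1 : lpN p (0 : 'rV[R]_n) <= 1.
Proof. by rewrite lpnorm0. Qed.

Lemma lp_octahedral_operator (s : seq X) (x0 : X) (k : R) :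
  octahedral (Lfin n X) (opnorm (@lpN R n p)) -> 0 < k -> k <= 1 ->
  in_span s x0 -> x0 != 0 ->
  exists T : 'rV[R]_n -> X, [/\ is_linear T, forall y, `|T y| <= lpN p y &
    forall z y, in_span s z -> (1 - k) * (`|z| + lpN p y) <= `|z + T y|].
Proof.
move=> octX k0 k1 sx0 x0N0.
have k20 : 0 < k / 2 by rewrite divr_gt0.
have [d d0 unif] := lpnorm_uniformly_convex (n := n) p p1 (k / 2) k20.
(* The condition 3 e <= d serves uniform convexity; 12 e <= k keeps the total loss 6 e + k/2 in the
   unit case below k. *)
pose e := Num.min (d / 3) (k / 12).
have e0 : 0 < e by rewrite lt_min !divr_gt0.
have ed : 3 * e <= d.
  have : e <= d / 3 by rewrite ge_min lexx.
  lra.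
have ek : 12 * e <= k.
  have : e <= k / 12 by rewrite ge_min lexx orbT.
  lra.
(* These operators span all [lpdual y] (x) z with z in the span of [s], for every y at once, so a
   single T serves all y. *)
pose L := [seq (fun v : 'rV[R]_n => v ord0 i *: x) | i <- enum 'I_n, x <- s].
have L_Lfin F : F \in L -> Lfin n X F.
  move=> /allpairsP[[i x] [_ _ ->]] a u v /=.
  by rewrite !mxE scalerDl scalerA.
have [T TL [T1 octT]] := octX L L_Lfin e e0.
have Tb : ball_bounded (@lpN R n p) T by exact: Lfin_lpnorm_bounded.
have T0 : T (0 : 'rV[R]_n) = 0 := is_linear0 T TL.
have T_le y : `|T y| <= lpN p y.
  rewrite -[leRHS]mul1r -T1; apply: le_opnormM => //.
  - exact: lpnormZ.
  - exact: lpnorm_ge0.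
  - exact: lpnorm_eq0.
have rank1_span z y : in_span s z -> in_span L (fun u => lpdual p y u *: z).
  move=> [c ->].
  have -> : (fun u => lpdual p y u *: \sum_(j < size s) c j *: s`_j) =
      \sum_(i < n) \sum_(j < size s)
        (`|y ord0 i| `^ (p - 1) * Num.sg (y ord0 i) * c j) *:
        (fun v : 'rV[R]_n => v ord0 i *: s`_j).
    apply/funext => u; rewrite fct_sumE /lpdual scaler_suml; apply: eq_bigr => i _.
    rewrite fct_sumE scaler_sumr; apply: eq_bigr => j _.
    by rewrite fctE !scalerA; congr (_ *: _); ring.
  do 2 (apply: (@lin_subspace_sum _ _ [set x | in_span _ x]) => [|? _];
    first exact: lin_subspace_span).
  by apply: in_spanZ; apply: mem_in_span; rewrite allpairs_f ?mem_enum ?mem_nth.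
(* The operator [F] of rank one attains its norm only near [y] and [-y]; a point
   where [F + T] almost attains its norm is therefore close to [y] up to sign. *)
have unit_case z y : in_span s z -> `|z| = 1 -> lpN p y = 1 ->
    2 - k <= `|z + T y|.
  move=> sz z1 y1; pose F u := lpdual p y u *: z.
  have Fb : ball_bounded (@lpN R n p) F.
    exists 1 => u u1; rewrite normrZ z1 mulr1.
    by rewrite (le_trans (lpdual_le _ _ _ _ _)).
  have F1 : 1 <= opnorm (@lpN R n p) F.
    have := le_opnorm (@lpN R n p) F y Fb; rewrite /F normrZ z1 lpdual_self//.
    by rewrite y1 powR1 normr1 mulr1; apply.
  have := octT _ (rank1_span z y sz) 1; rewrite scale1r normr1 => octF.
  (* Octahedrality gives at least 2 - 2 e; one more e makes the inequality strict, so that some u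
     exceeds it. *)
  have /lt_opnorm_ex-/(_ lpN0_le1)[u u1 uF] :
      2 - 3 * e < opnorm (@lpN R n p) (F + T).
    apply: lt_le_trans octF; rewrite -/F; nra.
  have [{uF}u [{}u1 Du Fu]] : exists u, [/\ lpN p u <= 1, 0 <= lpdual p y u &
      2 - 3 * e < `|lpdual p y u *: z + T u|].
    have [D0|D0] := leP 0 (lpdual p y u); first by exists u.
    exists (- u); rewrite lpnormN// -(scaleN1r u) lpdualZ (is_linearZ T _ u TL).
    rewrite scaleN1r mulN1r oppr_ge0.
    by rewrite scaleNr -opprD normrN; split => //; exact: ltW.
  have Du1 : lpdual p y u <= 1.
    by rewrite (le_trans (ler_norm _))// (le_trans (lpdual_le _ _ _ _ _)).
  have Dlt : 1 - 3 * e < lpdual p y u.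
    have := ler_normD (lpdual p y u *: z) (T u); rewrite normrZ z1 mulr1 ger0_norm//.
    have := le_trans (T_le u) u1; move: Fu; lra.
  (* The norm of u + y is at least [lpdual y (u + y)], which exceeds 2 - 3 e and hence 2 - d. *)
  have uy : lpN p (u - y) < k / 2.
    apply: unif; rewrite ?y1//.
    have := lpdual_le p p1 y (u + y) y1; rewrite lpdualD lpdual_self// y1 powR1.
    move=> /(le_trans (ler_norm _)); move: Dlt ed; lra.
  have -> : z + T y = (lpdual p y u *: z + T u) +
      ((1 - lpdual p y u) *: z - T (u - y)).
    by rewrite (is_linearB T _ _ TL) scalerBl scale1r opprB addrACA !subrKC.
  have := lerB_normD (lpdual p y u *: z + T u)
    ((1 - lpdual p y u) *: z - T (u - y)).
  have := ler_normB ((1 - lpdual p y u) *: z) (T (u - y)).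
  rewrite normrZ z1 mulr1 ger0_norm ?subr_ge0//.
  have := T_le (u - y); move: Fu Dlt uy ek.
  lra.
have unit_vec (V : normedModType R) (v : V) : v != 0 -> `| `|v|^-1 *: v | = 1.
  by move=> v0; rewrite normrZ normfV normr_id mulVf// normr_eq0.
exists T; split=> // z y sz.
have [->|yN0] := eqVneq y 0.
  by rewrite lpnorm0// T0 !addr0 ler_piMl// gerBl ltW.
have y0 : 0 < lpN p y.
  rewrite lt_def lpnorm_ge0 andbT; apply: contra yN0 => /eqP y0.
  by apply/eqP; apply: lpnorm_eq0 y0.
pose y' := (lpN p y)^-1 *: y.
have y'1 : lpN p y' = 1.
  by rewrite lpnormZ// ger0_norm ?invr_ge0 ?lpnorm_ge0// mulVf ?gt_eqF.
have -> : T y = lpN p y *: T y'.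
  by rewrite (is_linearZ T _ _ TL) scalerA mulfV ?gt_eqF// scale1r.
(* For z = 0 the unit case is applied to the normalised [x0], and the triangle inequality leaves at
   least 1 - k for [T y']. *)
have [->|zN0] := eqVneq z 0.
  rewrite normr0 !add0r normrZ ger0_norm ?lpnorm_ge0// mulrC ler_pM2l//.
  have := unit_case _ y' (in_spanZ _ `|x0|^-1 _ sx0) (unit_vec _ _ x0N0) y'1.
  have := ler_normD (`|x0|^-1 *: x0) (T y'); rewrite unit_vec//; lra.
have zz : z = `|z| *: (`|z|^-1 *: z) by rewrite scalerA mulfV ?normr_eq0// scale1r.
rewrite {2}zz; apply: norm_add_ge_homogeneous; rewrite ?lpnorm_ge0 ?(ltW k0)//.
- by rewrite unit_vec.
- by rewrite -y'1.
- by apply: unit_case => //; [exact: in_spanZ|exact: unit_vec].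
Qed.

End lp_octahedral.

(** For p so large that the l_p norm is at most 1 + t times the sup norm, the operator for l_p^n
    divided by 1 + t is a contraction for the sup norm. The factor lost is (1 - t)/(1 + t), which is
    at least 1 - 2 t. *)
Lemma linfty_operator {R : realType} {X : normedModType R} :
  (forall (p : R) (n : nat), 1 < p ->
      octahedral (Lfin n.+1 X) (opnorm (@lpnorm R n.+1 p))) ->
  forall (eps : R) (s : seq X) (n : nat), 0 < eps ->
  exists T : 'rV[R]_n.+1 -> X,
    [/\ is_linear T, opnorm (@linfnorm R n.+1) T <= 1 &
    forall (y : 'rV[R]_n.+1) (z : X), in_span s z ->
      (1 - eps) * (`|z| + linfnorm y) <= `|z + T y|].
Proof.
move=> octX eps s n eps0.
have {}octX (p : R) m : 1 < p -> octahedral (Lfin m.+1 X) (opnorm (@lpN R m.+1 p)).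
  by rewrite lpN.unlock; exact: octX.
(* Octahedrality provides an operator of norm 1 into X, so X is non-zero. *)
have [x0 x0N0] : exists x0 : X, x0 != 0.
  have two1 : 1 < 2 :> R by rewrite ltr1n.
  have [//|T TL [T1 _]] := octX 2 0%N two1 [::] _ 1 ltr01.
  have : 0 < opnorm (@lpN R 1 2) T by rewrite T1.
  case/lt_opnorm_ex => [|v _ Tv0]; first by rewrite lpnorm0.
  by exists (T v); rewrite -normr_gt0.
pose t := Num.min eps 1 / 2.
have t0 : 0 < t by rewrite divr_gt0// lt_min eps0/=.
have t1 : 2 * t <= 1.
  have : Num.min eps 1 <= 1 by rewrite ge_min lexx orbT.
  rewrite /t; lra.
have te : 2 * t <= eps.
  have : Num.min eps 1 <= eps by rewrite ge_min lexx.
  rewrite /t; lra.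
(* With this p, Bernoulli's inequality bounds (1 + t)^p below by 1 + p t = 1 + t + [n.+1]. *)
pose p := 1 + n.+1%:R / t.
have p1 : 1 < p by rewrite ltrDl divr_gt0.
have p0 : 0 < p by exact: lt_trans p1.
have Np : n.+1%:R `^ p^-1 <= 1 + t.
  have t1_ge0 : 0 <= 1 + t by rewrite addr_ge0 ?(ltW t0).
  have Np : n.+1%:R <= (1 + t) `^ p.
    have t_neq0 : 1 + t != 1 by rewrite -subr_eq0 addrC addKr gt_eqF.
    have := powR_bernoulli_lt p (1 + t) p1 t1_ge0 t_neq0.
    have -> : 1 + p * (1 + t - 1) = 1 + t + n.+1%:R.
      by rewrite /p; field; rewrite gt_eqF.
    move=> /ltW; apply: le_trans; rewrite lerDr//.
  have pV_ge0 : 0 <= p^-1 by rewrite invr_ge0 ltW.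
  have := ge0_ler_powR pV_ge0 (ler0n _ _) (powR_ge0 _ _) Np.
  by rewrite -powRrM mulfV ?gt_eqF// powRr1.
have k1 : t <= 1 by lra.
(* Adjoining [x0] ensures that the span contains a non-zero vector. *)
have sx0 : in_span (x0 :: s) x0 by apply: mem_in_span; rewrite inE eqxx.
have [T [TL T_le HT]] :=
  lp_octahedral_operator p p1 (x0 :: s) x0 t (octX p n p1) t0 k1 sx0 x0N0.
have t1_gt0 : 0 < 1 + t by rewrite addr_gt0.
have linf_ge0 (y : 'rV[R]_n.+1) : 0 <= linfnorm y by apply: bigmax_ge_id.
exists ((1 + t)^-1 *: T); split.
- exact: is_linear_lin_subspace.2.2.
- apply: opnorm_le => [|y y1].
    by apply: bigmax_le => // i _; rewrite mxE normr0.
  rewrite fctE normrZ ger0_norm ?invr_ge0 ?(ltW t1_gt0)// mulrC ler_pdivrMr//.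
  rewrite (le_trans (T_le y))// (le_trans (lpnorm_le_linfnorm p p1 y))// mul1r.
  by rewrite (le_trans _ Np)// ler_piMr// powR_ge0.
move=> y z sz; rewrite fctE -is_linearZ//.
have {}sz : in_span (x0 :: s) z.
  apply: in_span_sub sz; first exact: lin_subspace_span.
  by move=> x xs; apply: mem_in_span; rewrite inE xs orbT.
apply: le_trans (HT _ _ sz); rewrite lpnormZ// ger0_norm ?invr_ge0 ?(ltW t1_gt0)//.
apply: (@le_trans _ _ ((1 - t) * (1 + t)^-1 * (`|z| + linfnorm y))).
  rewrite ler_wpM2r ?addr_ge0// ler_pdivlMr//; nra.
rewrite -mulrA ler_wpM2l ?subr_ge0// mulrDr lerD//.
  by rewrite ler_piMl// invf_le1// lerDl ltW.
by rewrite ler_wpM2l ?invr_ge0 ?(ltW t1_gt0)// linfnorm_le_lpnorm.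
Qed.
(* Hahn-Banach, by Zorn's lemma on the graphs of norm-dominated functionals
   defined on subspaces containing [x]. *)
Section hahn_banach.
Context {R : realType} {V : normedModType R} (x : V).

(** The last clause admits the empty graph, which is the union of the empty chain. Linearity and
    domination together make such a graph single-valued. *)
Let dominated_graph (G : set (V * R)) :=
  [/\ forall (a : R) u v, G u -> G v -> G (a *: u.1 + v.1, a * u.2 + v.2),
      forall u, G u -> u.2 <= `|u.1| & G !=set0 -> G (x, `|x|)].

(** Domination at u - v and at w + v confines the value c at v between two families of bounds, the
    lower ones never exceeding the upper ones; c is the supremum of the lower ones. Scaling reduces
    a general multiple of v to v or -v. *)
Let extend_graph (G : set (V * R)) (v : V) : dominated_graph G -> G (x, `|x|) ->
  exists c, dominated_graph [set (u.1 + t *: v, u.2 + t * c) | u in G & t in setT].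
Proof.
move=> [GL GN _] Gx.
have G0 : G (0, 0).
  by have := GL (-1) _ _ Gx Gx; rewrite /= scaleN1r mulN1r !addNr.
have GZ a u : G u -> G (a *: u.1, a * u.2).
  by move=> Gu; have := GL a _ _ Gu G0; rewrite /= !addr0.
pose E := [set u.2 - `|u.1 - v| | u in G].
have EM u w : G u -> G w -> u.2 - `|u.1 - v| <= `|w.1 + v| - w.2.
  move=> Gu Gw; have := GN _ (GL 1 _ _ Gu Gw); rewrite /= scale1r mul1r.
  have := ler_normD (u.1 - v) (w.1 + v); rewrite addrACA addNr addr0; lra.
have Ec w : G w -> sup E <= `|w.1 + v| - w.2.
  move=> Gw; apply: ge_sup; first by exists (0 - `|0 - v|), (0, 0).
  by move=> _ [u Gu <-]; exact: EM.
have cE u : G u -> u.2 - `|u.1 - v| <= sup E.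
  move=> Gu; apply: ub_le_sup; last by exists u.
  by exists (`|0 + v| - 0) => _ [w Gw <-]; exact: (EM _ (0, 0)).
exists (sup E); split.
- move=> a _ _ [u Gu [t _ <-]] [w Gw [r _ <-]] /=.
  exists (a *: u.1 + w.1, a * u.2 + w.2); first exact: GL.
  exists (a * t + r) => //=; congr (_, _); last by ring.
  by rewrite scalerDl scalerDr scalerA addrACA.
- move=> _ [u Gu [t _ <-]] /=.
  have [t0|t0|->] := ltgtP t 0; last by rewrite scale0r mul0r !addr0 GN.
    have s0 : 0 < - t by rewrite oppr_gt0.
    have /= := cE _ (GZ (- t)^-1 _ Gu).
    have -> : (- t)^-1 *: u.1 - v = (- t)^-1 *: (u.1 + t *: v).
      by rewrite scalerDr scalerA invrN mulNr mulVf ?lt_eqF// scaleN1r.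
    rewrite normrZ gtr0_norm ?invr_gt0// -mulrBr mulrC ler_pdivrMr//.
    lra.
  have /= := Ec _ (GZ t^-1 _ Gu).
  have -> : t^-1 *: u.1 + v = t^-1 *: (u.1 + t *: v).
    by rewrite scalerDr scalerA mulVf ?gt_eqF// scale1r.
  rewrite normrZ gtr0_norm ?invr_gt0// -mulrBr mulrC ler_pdivlMr//.
  lra.
by move=> _; exists (x, `|x|) => //; exists 0 => //=; rewrite scale0r mul0r !addr0.
Qed.

Lemma norming_functional : exists f : V -> R,
  [/\ forall a u v, f (a *: u + v) = a * f u + f v, forall v, `|f v| <= `|v| &
      f x = `|x|].
Proof.
have [G [PG Gmax]] : exists G, dominated_graph G /\
    forall G', G `<` G' -> ~ dominated_graph G'.
  apply: Zorn_bigcup => F FP Ftot; split.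
  - move=> a u v [A FA Au] [B FB Bv].
    have [AB|BA] := Ftot _ _ FA FB.
      by exists B => //; have [GL _ _] := FP _ FB; apply: GL => //; exact: AB.
    by exists A => //; have [GL _ _] := FP _ FA; apply: GL => //; exact: BA.
  - by move=> u [A FA Au]; have [_ GN _] := FP _ FA; exact: GN.
  - move=> [u [A FA Au]]; exists A => //.
    by have [_ _ Gx] := FP _ FA; apply: Gx; exists u.
have [GL GN G_x] := PG.
have Gx : G (x, `|x|).
  apply: contrapT => nGx.
  have G0 : G = set0.
    by apply/eqP; rewrite -[_ == _]negbK; apply/negP => /set0P/G_x.
  (* The functional on the line through x properly extends the empty graph, so a maximal graph is
     not empty. *)
  pose L := [set (t *: x, t * `|x|) | t in [set: R]].
  apply: (Gmax L).
    rewrite G0; split=> [//|/(_ (0 *: x, 0 * `|x|))]; apply.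
    by exists 0.
  split.
  - move=> a _ _ [t _ <-] [r _ <-] /=; exists (a * t + r) => //.
    by congr (_, _); [rewrite scalerDl scalerA|ring].
  - by move=> _ [t _ <-] /=; rewrite normrZ ler_wpM2r// ler_norm.
  - by move=> _; exists 1 => //; rewrite scale1r mul1r.
have Gtot v : exists r, G (v, r).
  have [c] := extend_graph G v PG Gx.
  set G' := (X in dominated_graph X) => PG'; exists c.
  have G0 : G (0, 0).
    by have := GL (-1) _ _ Gx Gx; rewrite /= scaleN1r mulN1r !addNr.
  have G'v : G' (v, c).
    by exists (0, 0) => //; exists 1 => //=; rewrite !add0r scale1r mul1r.
  apply: contrapT => nGv; apply: (Gmax G') => //; split => [u Gu|/(_ _ G'v)//].
  exists u => //; exists 0 => //; rewrite scale0r mul0r !addr0.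
  by case: u {Gu}.
have [f Gf] := choice Gtot.
have Guniq v r t : G (v, r) -> G (v, t) -> r = t.
  have le a b : G (v, a) -> G (v, b) -> b <= a.
    move=> Ga Gb; have := GN _ (GL (-1) _ _ Ga Gb).
    by rewrite /= scaleN1r addNr normr0 mulN1r addrC subr_le0.
  by move=> Gr Gt; apply/eqP; rewrite eq_le !le.
have fL a u v : f (a *: u + v) = a * f u + f v.
  by apply: (Guniq (a *: u + v)); [exact: Gf|exact: (GL a _ _ (Gf u) (Gf v))].
exists f; split => //; last exact: (Guniq x).
have f0 : f 0 = 0.
  by have := fL (-1) 0 0; rewrite scaler0 addr0 mulN1r addNr.
move=> v; have fv := GN _ (Gf v); have fNv := GN _ (Gf (- v)).
have fN : f (- v) = - f v.
  by have := fL (-1) v 0; rewrite !addr0 scaleN1r f0 addr0 mulN1r.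
by move: fv fNv; rewrite /= fN normrN ler_norml lerNl => -> ->.
Qed.

End hahn_banach.

(** * Finite norming sets for finite dimensional spaces of operators *)

(** A basis is built by induction: a generator already in the span of the basis is dropped, any
    other is prepended. It gives the span coordinates, so that compactness in R^k applies. *)
Lemma independent_generators {R : realType} {V : lmodType R} (s : seq V) :
  exists (k : nat) (b : 'I_k -> V), [/\ forall i, in_span s (b i),
    forall x, in_span s x -> exists c : 'I_k -> R, x = \sum_(i < k) c i *: b i &
    forall c : 'I_k -> R, \sum_(i < k) c i *: b i = 0 -> forall i, c i = 0].
Proof.
elim: s => [|y s [k [b [sb span_b free_b]]]].
  exists 0%N, (fun=> 0); split=> [[]//|x [c ->]|c _ []//].
  by exists (fun=> 0); rewrite !big_ord0.
have span_cons x : in_span (y :: s) x -> exists a x', in_span s x' /\ x = a *: y + x'.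
  move=> [c ->]; exists (c ord0), (\sum_(i < size s) c (lift ord0 i) *: s`_i).
  by split; [exists (fun i => c (lift ord0 i))|rewrite big_ord_recl].
have sub_cons x : in_span s x -> in_span (y :: s) x.
  apply: (in_span_sub s [set z | in_span (y :: s) z]); first exact: lin_subspace_span.
  by move=> z zs; apply: mem_in_span; rewrite inE zs orbT.
have [[d yE]|ynb] := pselect (exists d : 'I_k -> R, y = \sum_(i < k) d i *: b i).
  exists k, b; split => //; first by move=> i; exact/sub_cons/sb.
  move=> x /span_cons[a [x' [/span_b[c ->] ->]]].
  exists (fun i => a * d i + c i); rewrite yE scaler_sumr -big_split/=.
  by apply: eq_bigr => i _; rewrite scalerDl scalerA.
exists k.+1, (fun i => if unlift ord0 i is Some j then b j else y).
have sumE (c : 'I_k.+1 -> R) :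
    \sum_(i < k.+1) c i *: (if unlift ord0 i is Some j then b j else y) =
    c ord0 *: y + \sum_(i < k) c (lift ord0 i) *: b i.
  by rewrite big_ord_recl unlift_none; under eq_bigr do rewrite liftK.
split.
- move=> i; case: unliftP => [j _|_]; first exact/sub_cons/sb.
  by apply: mem_in_span; rewrite inE eqxx.
- move=> x /span_cons[a [x' [/span_b[c ->] ->]]].
  exists (fun i => if unlift ord0 i is Some j then c j else a).
  by rewrite sumE unlift_none; congr (_ + _); under [RHS]eq_bigr do rewrite liftK.
move=> c; rewrite sumE => c0.
have c00 : c ord0 = 0.
  apply: contrapT => /eqP cN0; apply: ynb.
  exists (fun i => - (c ord0)^-1 * c (lift ord0 i)).
  under eq_bigr do rewrite -scalerA.
  rewrite -scaler_sumr scaleNr -scalerN; apply: (scalerI cN0).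
  rewrite scalerA mulfV// scale1r; apply/eqP.
  by rewrite -subr_eq0 opprK c0.
move: c0; rewrite c00 scale0r add0r => /free_b c0 i.
by have [j ->|->//] := unliftP ord0 i.
Qed.

Section finite_norming_set.
Context {R : realType} {Y X : normedModType R}.
Let N := @opnorm R Y X (fun y : Y => `|y|).

Let N0 : `|0 : Y| <= 1. Proof. by rewrite normr0. Qed.

Lemma Lop_opnorm_le (T : Y -> X) v : Lop Y X T -> `|T v| <= N T * `|v|.
Proof.
move=> LT; apply: le_opnormM => //; last exact: Lop_ball_bounded.
- exact: normrZ.
- by move=> u /normr0_eq0.
- exact: LT.1.
Qed.

Lemma Lop_in_span (s : seq (Y -> X)) (T : Y -> X) :
  (forall T, T \in s -> Lop Y X T) -> in_span s T -> Lop Y X T.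
Proof. by move=> sL; apply: in_span_sub => //; exact: Lop_lin_subspace. Qed.

Lemma Lop_near_norming (T : Y -> X) (e : R) : Lop Y X T -> 0 < e -> e < 1 ->
  0 < N T -> exists2 y, `|y| = 1 & (1 - e) * N T < `|T y|.
Proof.
move=> LT e0 e1 NT0.
have : (1 - e) * N T < N T by rewrite gtr_pMl// gtrBl.
move=> /lt_opnorm_ex-/(_ N0)[y y1 Ty].
have Ty0 : 0 < `|T y| by apply: lt_trans Ty; rewrite mulr_gt0// subr_gt0.
have y0 : 0 < `|y|.
  rewrite normr_gt0; apply: contraTneq Ty0 => ->.
  by rewrite (is_linear0 T LT.1) normr0 ltxx.
exists (`|y|^-1 *: y); first by rewrite normrZ normfV normr_id mulVf ?gt_eqF.
apply: (lt_le_trans Ty); rewrite (is_linearZ T _ _ LT.1) normrZ normfV normr_id.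
by rewrite ler_peMl// invf_ge1.
Qed.

(** On the unit sphere K of coordinates, independence keeps the operator norm positive. A vector
    almost norming [T c] still almost norms [T d] for d near c, so finitely many vectors suffice on
    K, and homogeneity covers the rest. *)
Lemma finite_norming_set (s : seq (Y -> X)) (e : R) : nonzero Y ->
  (forall T, T \in s -> Lop Y X T) -> 0 < e -> e < 1 ->
  exists F : seq Y, [/\ F != [::], forall y, y \in F -> `|y| = 1 &
    forall T, in_span s T -> exists2 y, y \in F & (1 - e) * N T <= `|T y|].
Proof.
move=> [v0 v0N0] sL e0 e1.
have [k [b [sb span_b free_b]]] := independent_generators s.
pose T (c : 'rV[R]_k) := \sum_(i < k) c ord0 i *: b i.
have bL i : Lop Y X (b i) by exact: Lop_in_span (sb i).
have TLop c : Lop Y X (T c).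
  apply: lin_subspace_sum => [|i _]; first exact: Lop_lin_subspace.
  by apply: Lop_lin_subspace.2.2; exact: bL.
have Tb c : ball_bounded (fun y : Y => `|y|) (T c) by exact: Lop_ball_bounded.
have TB c d : T (c - d) = T c - T d.
  rewrite /T -sumrB; apply: eq_bigr => i _; by rewrite !mxE scalerBl.
pose C := \sum_(i < k) N (b i).
have N_ge0 S : Lop Y X S -> 0 <= N S.
  by move=> LS; apply: opnorm_ge0 => //; exact: Lop_ball_bounded.
have C0 : 0 <= C by apply: sumr_ge0 => i _; exact: N_ge0.
have TC c : N (T c) <= C * `|c|.
  apply: opnorm_le => // v v1; rewrite /T fct_sumE (le_trans (ler_norm_sum _ _ _))//.
  rewrite mulr_suml ler_sum// => i _; rewrite fctE normrZ mulrC ler_pM//.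
    by rewrite (le_trans (Lop_opnorm_le _ _ (bL i)))// ler_piMr// N_ge0.
  by rewrite -linfnorm_mx_norm (le_bigmax _ (fun i => `|c ord0 i|)).
have Tlip c d : N (T d) <= N (T c) + C * `|c - d|.
  have -> : T d = T c + T (d - c) by rewrite TB subrKC.
  by rewrite (le_trans (opnormD _ _ _ _ _ _))// lerD2l distrC.
have TlipN c d y : `|y| = 1 -> `|T c y| - C * `|c - d| <= `|T d y|.
  move=> y1; have := lerB_dist (T c y) (T d y).
  have -> : T c y - T d y = T (c - d) y by rewrite TB.
  have := Lop_opnorm_le _ y (TLop (c - d)); rewrite y1 mulr1.
  have := TC (c - d); lra.
pose K := [set c : 'rV[R]_k | `|c| = 1].
have cK : compact K.
  apply: bounded_closed_compact.
    exists 1; split => // M M1 c Kc; have c1 : `|c| <= 1 by rewrite Kc.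
    exact: le_trans c1 (ltW M1).
  apply: (@closed_comp _ _ (fun c : 'rV[R]_k => `|c|) [set 1]).
    by move=> c _; exact: norm_continuous.
  exact: closed_eq.
pose U y := interior [set c | (1 - e) * N (T c) <= `|T c y|].
have : cover_compact K by rewrite -compact_cover.
move=> /(_ Y [set y | `|y| = 1] U)[].
- by move=> y _; exact: open_interior.
- move=> c c1.
  have NT0 : 0 < N (T c).
    rewrite lt_def N_ge0// andbT; apply/eqP => NT0.
    have Tc0 : T c = 0.
      apply/funext => y; apply/eqP; rewrite -normr_le0.
      by rewrite (le_trans (Lop_opnorm_le _ y (TLop c)))// NT0 mul0r.
    have cE : c = 0.
      by apply/rowP => i; rewrite mxE; exact: (free_b (fun i => c ord0 i) Tc0).
    by move: c1; rewrite /K/= cE normr0 => /esym/eqP; rewrite oner_eq0.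
  have [y y1 Ty] := Lop_near_norming _ _ (TLop c) e0 e1 NT0.
  exists y => //; rewrite /U /interior /=.
  pose g := `|T c y| - (1 - e) * N (T c).
  have g0 : 0 < g by rewrite subr_gt0.
  (* Both sides of the norming inequality vary by at most C |c - d|, so twice C + 1 covers their
     joint variation within the gap g. *)
  have C1 : 0 < 2 * (C + 1) by rewrite mulr_gt0// ltr_wpDl.
  near=> d.
  have cd : `|c - d| * (2 * (C + 1)) < g.
    rewrite -ltr_pdivlMr//; near: d; apply: cvgr_dist_lt => //.
    by rewrite divr_gt0.
  have h1 : 0 <= e * (C * `|c - d|) by rewrite mulr_ge0 ?(ltW e0)// mulr_ge0.
  have h2 : (1 - e) * N (T d) <= (1 - e) * (N (T c) + C * `|c - d|).
    by rewrite ler_wpM2l// subr_ge0 ltW.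
  have := TlipN c d y y1; have := normr_ge0 (c - d); move: cd h1 h2; rewrite /g /=.
  lra.
move=> D DS KD.
(* The extra unit vector keeps the list non-empty and serves the operators of norm 0. *)
exists (`|v0|^-1 *: v0 :: finmap.enum_fset D); split => //.
  move=> y; rewrite inE => /orP[/eqP->|yD].
    by rewrite normrZ normfV normr_id mulVf// normr_eq0.
  by have := DS _ yD; rewrite inE.
move=> S /span_b[c0 SE]; pose c : 'rV[R]_k := \row_i c0 i.
have {SE} -> : S = T c by rewrite SE; apply: eq_bigr => i _; rewrite mxE.
have [NT0|NT0] := eqVneq (N (T c)) 0.
  by exists (`|v0|^-1 *: v0); rewrite ?inE ?eqxx// NT0 mulr0.
have cN0 : `|c| != 0.
  apply: contra NT0 => /eqP cc0; rewrite eq_le N_ge0// andbT.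
  by rewrite (le_trans (TC c))// cc0 mulr0.
pose c1 := `|c|^-1 *: c.
have Kc1 : K c1 by rewrite /K/= normrZ normfV normr_id mulVf.
have [y yD Uy] := KD _ Kc1; exists y; first by rewrite inE yD orbT.
have /interior_subset/= := Uy.
have -> : T c1 = `|c|^-1 *: T c.
  by rewrite /T scaler_sumr; apply: eq_bigr => i _; rewrite !mxE scalerA.
rewrite fctE normrZ /N opnormZ// normfV normr_id mulrCA ler_pM2l//.
by rewrite invr_gt0 lt_def cN0 normr_ge0.
Unshelve. all: by end_near. Qed.

End finite_norming_set.

(** * From (6) to (1) *)

Lemma linfty_operator_octahedral {R : realType} {X : completeNormedModType R} :
  (forall (eps : R) (Z : set X) (n : nat), 0 < eps ->
      lin_subspace Z -> (exists s : seq X, forall z, Z z <-> in_span s z) ->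
      exists T : 'rV[R]_n.+1 -> X,
        is_linear T /\ opnorm (@linfnorm R n.+1) T <= 1 /\
        forall (y : 'rV[R]_n.+1) (z : X), Z z ->
          (1 - eps) * (`|z| + linfnorm y) <= `|z + T y|) ->
  forall (Y : completeNormedModType R) (H : set (Y -> X)),
    nonzero Y -> lin_subspace H -> H `<=` Lop Y X -> Fop Y X `<=` H ->
    octahedral H (opnorm (fun y : Y => `|y|)).
Proof.
move=> embX Y H Yn0 HS HL FH s sH eps eps0.
set N := opnorm _.
have N0 : `|0 : Y| <= 1 by rewrite normr0.
(* A factor 1 - e is lost in norming T and another in the estimate for [T0]; (1 - e)^2 >= 1 - 2 e >=
   1 - [eps]. *)
pose e := Num.min eps 1 / 2.
have e0 : 0 < e by rewrite divr_gt0// lt_min eps0/=.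
have e1 : e < 1.
  have : Num.min eps 1 <= 1 by rewrite ge_min lexx orbT.
  rewrite /e; lra.
have eeps : 2 * e <= eps.
  have : Num.min eps 1 <= eps by rewrite ge_min lexx.
  rewrite /e; lra.
have sL T : T \in s -> Lop Y X T by move=> /sH/HL.
have [F [FN0 F1 norming]] := finite_norming_set s e Yn0 sL e0 e1.
have [n sizeF] : exists n, size F = n.+1.
  by case: (F) FN0 => // y F' _; exists (size F').
have [f fP] := choice (fun x : Y => norming_functional x).
pose Phi (y : Y) : 'rV[R]_n.+1 := \row_i f F`_i y.
have PhiL : is_linear Phi.
  by move=> a u v; apply/rowP => i; rewrite !mxE; have [fL _ _] := fP F`_i.
have Phi_le y : linfnorm (Phi y) <= `|y|.
  by apply: bigmax_le => // i _; rewrite mxE; have [_ -> _] := fP F`_i.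
have Phi_ge y : y \in F -> 1 <= linfnorm (Phi y).
  move=> yF; have iF : (index y F < n.+1)%N by rewrite -sizeF index_mem.
  have := @le_bigmax _ _ _ 0 (fun i => `|Phi y ord0 i|) (Ordinal iF).
  apply: le_trans; rewrite mxE /= nth_index//.
  by have [_ _ ->] := fP y; rewrite normr_id F1.
pose L := [seq T y | T : Y -> X <- s, y <- F].
have [T0 [T0L [T0_le1 T0P]]] := embX e _ n e0 (lin_subspace_span L)
  (ex_intro _ L (fun z => iff_refl _)).
have T0b : ball_bounded (@linfnorm R n.+1) T0.
  exists (\sum_(i < n.+1) `|T0 (delta_mx ord0 i)|) => v v1.
  rewrite -[leRHS]mulr1; apply: is_linear_row_bound => // i.
  by apply: le_trans v1; exact: (le_bigmax _ (fun i => `|v ord0 i|)).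
have T0_le v : `|T0 v| <= linfnorm v.
  apply: (@le_trans _ _ (opnorm (@linfnorm R n.+1) T0 * linfnorm v)).
    apply: le_opnormM => //.
    - by rewrite linfnorm_mx_norm normr0.
    - by move=> a u; rewrite !linfnorm_mx_norm normrZ.
    - by move=> u; rewrite linfnorm_mx_norm.
    - by move=> u; rewrite linfnorm_mx_norm => /normr0_eq0.
  by rewrite ler_piMl// linfnorm_mx_norm.
pose S0 : Y -> X := T0 \o Phi.
have S0L : is_linear S0 by move=> a u v; rewrite /S0/= PhiL T0L.
have S0_le v : `|S0 v| <= `|v| by exact: le_trans (T0_le _) (Phi_le _).
have S0Lop : Lop Y X S0 by split => //; exists 1 => v; rewrite mul1r.
have S0b := Lop_ball_bounded _ S0Lop.
have HS0 : H S0.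
  apply: FH; split => //.
  exists [seq T0 (delta_mx ord0 i) | i <- enum 'I_n.+1] => v.
  rewrite /S0/= (row_sum_delta (Phi v)) is_linear_sum//.
  apply: (@lin_subspace_sum _ _ [set x | in_span _ x]).
    exact: lin_subspace_span.
  move=> i _; rewrite is_linearZ//; apply: in_spanZ; apply: mem_in_span.
  by rewrite map_f// mem_enum.
pose m := N S0.
have m1 : m <= 1 by apply: opnorm_le => // v v1; exact: le_trans (S0_le v) v1.
(* The estimate for [T0] at z = 0 bounds [S0] away from 0 at the norming vectors. *)
have m0 : 0 < m.
  have [y yF] : exists y, y \in F.
    by case: (F) FN0 => // y F' _; exists y; rewrite inE eqxx.
  have /(T0P (Phi y)) : in_span L 0 by exact: in_span0.
  rewrite normr0 !add0r => Sy.
  have : 0 < (1 - e) * linfnorm (Phi y).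
    by rewrite mulr_gt0 ?subr_gt0// (lt_le_trans _ (Phi_ge y yF)).
  move=> /lt_le_trans /(_ Sy) /lt_le_trans; apply.
  by apply: (le_opnorm _ S0) => //; rewrite F1.
(* [S0] has norm m, possibly below 1; as m <= 1, normalising can only enlarge its values. *)
exists (m^-1 *: S0); first exact: HS.2.2.
split; first by rewrite /N opnormZ// gtr0_norm ?invr_gt0// mulVf ?gt_eqF.
move=> T sT l; have [y yF Ty] := norming T sT.
have LTy : in_span L (T y).
  case: sT => c ->; rewrite fct_sumE.
  apply: (@lin_subspace_sum _ _ [set x | in_span _ x]).
    exact: lin_subspace_span.
  move=> i _; rewrite fctE; apply: in_spanZ; apply: mem_in_span.
  by apply/allpairsP; exists (s`_i, y); rewrite mem_nth.
have LT : Lop Y X T by exact: Lop_in_span sT.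
have NT0 : 0 <= N T by apply: opnorm_ge0 => //; exact: Lop_ball_bounded.
apply: (@le_trans _ _ `|(T + l *: (m^-1 *: S0)) y|); last first.
  apply: le_opnorm; last by rewrite F1.
  apply: ball_boundedD; first exact: Lop_ball_bounded.
  by do 2 apply: ball_boundedZ.
have -> : (T + l *: (m^-1 *: S0)) y = T y + T0 ((l / m) *: Phi y).
  by rewrite (is_linearZ T0 _ _ T0L) -scalerA.
apply: le_trans (T0P _ _ LTy).
have : `|l| <= linfnorm ((l / m) *: Phi y).
  rewrite linfnorm_mx_norm normrZ normrM normfV (gtr0_norm m0) -linfnorm_mx_norm.
  rewrite -mulrA ler_peMr// mulrC -[leLHS]mulr1.
  by rewrite ler_pM// ?Phi_ge// invf_ge1.
have e1' : 0 <= 1 - e by rewrite subr_ge0 ltW.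
move=> /(lerD Ty)/(ler_wpM2l e1'); apply: le_trans.
have : 0 <= e * N T by rewrite mulr_ge0// ltW.
have : 0 <= e * e * N T := mulr_ge0 (mulr_ge0 (ltW e0) (ltW e0)) NT0.
have : 0 <= (eps - 2 * e) * (N T + `|l|).
  by apply: mulr_ge0; [rewrite subr_ge0|exact: addr_ge0 NT0 (normr_ge0 l)].
have : 0 <= e * `|l| := mulr_ge0 (ltW e0) (normr_ge0 l).
rewrite -/(N T); lra.
Qed.

(** * The cycle of implications; (1) to (4) are successive specialisations *)

Theorem theorem3p7 (R : realType) (X : completeNormedModType R) :
  [<->
  (* (1) *)
  (forall (Y : completeNormedModType R) (H : set (Y -> X)),
      nonzero Y -> lin_subspace H -> H `<=` Lop Y X -> Fop Y X `<=` H ->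
      octahedral H (opnorm (fun y : Y => `|y|)));
  (* (2) *)
  univ_octahedral X;
  (* (3) *)
  (forall Y : completeNormedModType R, nonzero Y -> findim Y ->
      octahedral (Lop Y X) (opnorm (fun y : Y => `|y|)));
  (* (4) *)
  (forall Y : completeNormedModType R, nonzero Y -> findim Y ->
      unif_convex Y -> octahedral (Lop Y X) (opnorm (fun y : Y => `|y|)));
  (* (5) *)
  (forall (p : R) (n : nat), 1 < p ->
      octahedral (Lfin n.+1 X) (opnorm (@lpnorm R n.+1 p)));
  (* (6) *)
  (forall (eps : R) (Z : set X) (n : nat), 0 < eps ->
      lin_subspace Z -> (exists s : seq X, forall z, Z z <-> in_span s z) ->
      exists T : 'rV[R]_n.+1 -> X,
        is_linear T /\ opnorm (@linfnorm R n.+1) T <= 1 /\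
        forall (y : 'rV[R]_n.+1) (z : X), Z z ->
          (1 - eps) * (`|z| + linfnorm y) <= `|z + T y|)
  ].
Proof.
tfae.
- move=> H Y Y0; apply: H => //; first exact: Lop_lin_subspace.
  by move=> T [].
- by move=> H Y Y0 _; exact: H.
- by move=> H Y Y0 Yfd _; exact: H.
- by move=> H p n p1; exact: octahedral_Lfin_lpnorm.
- move=> H eps Z n eps0 _ [s sZ].
  have [T [TL T1 TP]] := linfty_operator H eps s n eps0.
  by exists T; do 2 split => //; move=> y z /sZ; exact: TP.
- exact: linfty_operator_octahedral.
Qed.
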